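(* Let $k$ be a positive integer, let $\mathcal{X}$ and $\mathcal{Y}$ be $k$-labeled metric spaces and let $j$ be a nonnegative integer. Then $$\mathsf{Int}_{S_k}(\mathrm{LPH}_j(\mathcal{X}),\mathrm{LPH}_j(\mathcal{Y}))\le 2\cdot\mathsf{GH}_{S_k}(\mathcal{X},\mathcal{Y}).$$
   Context: A $k$-labeled metric space is a triple $\mathcal{X}=(X,d_X,L_X)$, where $(X,d_X)$ is a compact metric space and $L_X=(X_1,\ldots,X_k)$ is a finite sequence of nonempty subsets $X_i\subset X$ with $X=\bigcup_{i=1}^k X_i$ (the $X_i$ may overlap). For sets $A,B$, $\mathcal{C}(A,B)$ denotes the set of correspondences, i.e. subsets $C\subset A\times B$ whose coordinate projections to $A$ and to $B$ are both surjective. For $C\in\mathcal{C}(X_i,Y_i)$, $C'\in\mathcal{C}(X_j,Y_j)$, let $\mathrm{dis}(C,C'):=\sup_{(x,y)\in C,\ (x',y')\in C'}|d_X(x,x')-d_Y(y,y')|$, and $$\mathsf{GH}_k(\mathcal{X},\mathcal{Y}):=\frac12\inf_{(C_1,\ldots,C_k)}\ \max_{i,j=1,\ldots,k}\mathrm{dis}(C_i,C_j),\qquad C_i\in\mathcal{C}(X_i,Y_i).$$ For $\sigma$ in the symmetric group $S_k$, $\sigma\cdot\mathcal{X}:=(X,d_X,(X_{\sigma(1)},\ldots,X_{\sigma(k)}))$, and $\mathsf{GH}_{S_k}(\mathcal{X},\mathcal{Y}):=\min_{\sigma\in S_k}\mathsf{GH}_k(\sigma\cdot\mathcal{X},\mathcal{Y})$.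 Fix a field $\mathbb{F}$. For a poset $Q$, a $Q$-module is a functor $V:Q\to\mathrm{Vect}_{\mathbb{F}}$ from the poset category $Q$ to $\mathbb{F}$-vector spaces; morphisms are natural transformations. For a poset $(P,\preccurlyeq)$, $\mathbb{R}\times P$ has the product order. For an $(\mathbb{R}\times P)$-module $V$ and $\epsilon\ge0$, the shift $V_\epsilon$ is $V_\epsilon(r,p):=V(r+\epsilon,p)$. Modules $V,V'$ are $\epsilon$-interleaved if there are morphisms $\phi:V\to V'_\epsilon$ and $\psi:V'\to V_\epsilon$ such that $\psi_{r+\epsilon,p}\circ\phi_{r,p}=V((r,p)\preccurlyeq(r+2\epsilon,p))$ and $\phi_{r+\epsilon,p}\circ\psi_{r,p}=V'((r,p)\preccurlyeq(r+2\epsilon,p))$ for all $(r,p)$. Then $\mathsf{Int}(V,V'):=\inf\{\epsilon\ge0 : V,V'\text{ are }\epsilon\text{-interleaved}\}$, with $\inf\emptyset:=+\infty$. $P_k$ is the power set of $\{1,\ldots,k\}$ ordered by inclusion. $S_k$ acts on $P_k$ by $\sigma\cdot\{p_1,\ldots,p_\ell\}:=\{\sigma(p_1),\ldots,\sigma(p_\ell)\}$, and on $(\mathbb{R}\times P_k)$-modules by $(\sigma\cdot V)(r,p):=V(r,\sigma\cdot p)$. Define $\mathsf{Int}_{S_k}(V,V'):=\min_{\sigma\in S_k}\mathsf{Int}(\sigma\cdot V,V')$. For a metric space $S$, the Vietoris-Rips complex $\mathrm{VR}_r(S)$ is the simplicial complex whose simplices are the nonempty finite subsets $\sigma\subset S$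 with $\mathrm{diam}(\sigma)\le r$ (empty if $r<0$ or $S=\emptyset$). The labeled persistent homology $\mathrm{LPH}_j(\mathcal{X})$ is the $(\mathbb{R}\times P_k)$-module $\mathrm{LPH}_j(\mathcal{X})(r,p):=\mathrm{H}_j(\mathrm{VR}_r(\bigcup_{i\in p}X_i))$ (degree-$j$ simplicial homology with coefficients in $\mathbb{F}$), with structure maps induced by inclusions. *)

(* Defs.v *)
From HB Require Import structures.
From mathcomp Require Import all_boot all_order all_fingroup all_algebra.
From mathcomp Require Import generic_quotient ring_quotient.
From mathcomp Require Import all_classical all_reals ereal topology.
From mathcomp Require Import freeg.

Set Implicit Arguments.
Unset Strict Implicit.
Unset Printing Implicit Defensive.

Import Order.TTheory GRing.Theory Num.Theory.
Import preorder.Order.SetSubsetOrder.Exports Order.SetSubsetOrder.Exports.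
Import FreegDefs FreegDefs.Exports FreegZmodType FreegZmodType.Exports.

Local Open Scope classical_set_scope.
Local Open Scope ring_scope.

Section Subspaces.
Context (F : fieldType) (V : lmodType F).

Record subspace := Subspace {
  subspace_pred :> {pred V};
  subspaceP : submod_closed subspace_pred }.

HB.instance Definition _ (S : subspace) :=
  GRing.isSubmodClosed.Build F V (subspace_pred S) (subspaceP S).

Definition lspan_pred (G : set V) : {pred V} := fun v =>
  `[< exists2 s : seq (F * V),
        forall p, p \in s -> G p.2 & v = \sum_(p <- s) p.1 *: p.2 >].

Lemma lspan_submod_closed (G : set V) : submod_closed (lspan_pred G).
Proof.
split; first by apply/asboolP; exists [::] => //; rewrite big_nil.
move=> a u v /asboolP[s sG ->] /asboolP[t tG ->]; apply/asboolP.
exists ([seq (a * p.1, p.2) | p <- s] ++ t).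
  by move=> p; rewrite mem_cat => /orP[/mapP[q qs ->]|/tG//]; exact: (sG q).
rewrite big_cat big_map scaler_sumr /=; congr (_ + _).
by apply: eq_bigr => p _; rewrite scalerA.
Qed.

Definition lspan (G : set V) := Subspace (lspan_submod_closed G).

Lemma mem_lspan (G : set V) v : G v -> v \in lspan G.
Proof.
move=> Gv; apply/asboolP; exists [:: (1, v)].
  by move=> p; rewrite inE => /eqP ->.
by rewrite big_seq1 scale1r.
Qed.

Lemma lspan_sub (G : set V) (S : subspace) :
  (forall v, G v -> v \in S) -> {subset lspan G <= S}.
Proof.
move=> GS v /asboolP[s sG ->]; rewrite big_seq.
by apply: rpred_sum => p ps; rewrite rpredZ// GS//; exact: sG.
Qed.

End Subspaces.

Section SubspaceTypes.
Context (F : fieldType) (V : lmodType F).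

Definition lsub (S : subspace V) := {v : V | v \in S}.

HB.instance Definition _ (S : subspace V) := SubChoice.on (lsub S).
HB.instance Definition _ (S : subspace V) :=
  [SubChoice_isSubLmodule of lsub S by <:].

Definition lsub_incl (S T : subspace V) (ST : {subset S <= T}) (v : lsub S) :
  lsub T := exist _ (val v) (ST (val v) (valP v)).

Lemma lsub_incl_is_linear (S T : subspace V) (ST : {subset S <= T}) :
  linear (lsub_incl ST).
Proof.
move=> a u v; apply: val_inj; rewrite [RHS](linearP (val : lsub T -> V)).
exact: (linearP (val : lsub S -> V)).
Qed.

HB.instance Definition _ (S T : subspace V) (ST : {subset S <= T}) :=
  GRing.isLinear.Build F (lsub S) (lsub T) *:%R (lsub_incl ST)
    (lsub_incl_is_linear ST).

Lemma lsub_trace_submod_closed (S T : subspace V) :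
  submod_closed [pred v : lsub S | val v \in T].
Proof.
split=> [|a u v]; rewrite !inE ?linear0 ?rpred0// linearP => uT vT.
by rewrite rpredD ?rpredZ.
Qed.

(* S `&` T as a subspace of S *)
Definition lsub_trace (S T : subspace V) := Subspace (lsub_trace_submod_closed S T).

End SubspaceTypes.

Section QuotientSpace.
Context (F : fieldType) (V : lmodType F) (S : subspace V).

Definition lquot := Quotient.quot S.
HB.instance Definition _ := GRing.Zmodule.on lquot.

Definition lpi (v : V) : lquot := (\pi_(Quotient.quot S) v)%qT.

Lemma lpi_surj (q : lquot) : exists v, q = lpi v.
Proof. by exists (repr (q : Quotient.quot S)); rewrite /lpi reprK. Qed.

Lemma lpi_eq u v : (lpi u == lpi v) = (u - v \in S).
Proof. by rewrite Quotient.idealrBE. Qed.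

Definition lquot_scale (a : F) (q : lquot) : lquot :=
  lpi (a *: repr (q : Quotient.quot S)).

Lemma lpiD u v : lpi (u + v) = lpi u + lpi v.
Proof. exact: pi_addr. Qed.

Lemma lpi_scale a v : lquot_scale a (lpi v) = lpi (a *: v).
Proof.
apply/eqP; rewrite lpi_eq -scalerBr rpredZ//.
by rewrite -lpi_eq /lpi reprK.
Qed.

Lemma lquot_scaleA a b q :
  lquot_scale a (lquot_scale b q) = lquot_scale (a * b) q.
Proof. by have [v ->] := lpi_surj q; rewrite !lpi_scale scalerA. Qed.

Lemma lquot_scale1 : left_id 1 lquot_scale.
Proof. by move=> q; have [v ->] := lpi_surj q; rewrite lpi_scale scale1r. Qed.

Lemma lquot_scaleDr : right_distributive lquot_scale +%R.
Proof.
move=> a p q; have [u ->] := lpi_surj p; have [v ->] := lpi_surj q.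
by rewrite -lpiD !lpi_scale scalerDr lpiD.
Qed.

Lemma lquot_scaleDl q : {morph lquot_scale^~ q : a b / a + b}.
Proof.
by move=> a b; have [v ->] := lpi_surj q; rewrite !lpi_scale scalerDl lpiD.
Qed.

HB.instance Definition _ := GRing.Zmodule_isLmodule.Build F lquot
  lquot_scaleA lquot_scale1 lquot_scaleDr lquot_scaleDl.

Lemma lpi_is_linear : linear lpi.
Proof. by move=> a u v; rewrite lpiD -lpi_scale. Qed.

HB.instance Definition _ := GRing.isLinear.Build F V lquot *:%R lpi lpi_is_linear.

End QuotientSpace.
Arguments lpi : simpl never.

Section QuotientMap.
Context (F : fieldType) (V W : lmodType F).
Context (S : subspace V) (f : {linear V -> W}).

Definition lquot_lift (fS : {in S, forall v, f v = 0}) (q : lquot S) : W :=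
  f (repr (q : Quotient.quot S)).

Arguments lquot_lift : simpl never.

Context (fS : {in S, forall v, f v = 0}).

Lemma lquot_liftE v : lquot_lift fS (lpi S v) = f v.
Proof.
apply/eqP; rewrite -subr_eq0 -linearB fS//.
by rewrite -lpi_eq /lpi reprK.
Qed.

Lemma lquot_lift_is_linear : linear (lquot_lift fS).
Proof.
move=> a p q; have [u ->] := lpi_surj p; have [v ->] := lpi_surj q.
by rewrite -linearP !lquot_liftE linearP.
Qed.

HB.instance Definition _ :=
  GRing.isLinear.Build F (lquot S) W *:%R (lquot_lift fS) lquot_lift_is_linear.

End QuotientMap.

Section FreeModule.
Context (F : fieldType) (K : choiceType) (M : lmodType F) (f : K -> M).

Lemma fglift_is_linear : linear (fglift f : {freeg K / F} -> M).
Proof.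
have fB : {morph (fglift f : {freeg K / F} -> M) : x y / x - y}.
  exact: lift_is_additive.
have f0 : fglift f (0 : {freeg K / F}) = 0 by rewrite -(subrr 0) fB subrr.
have fN x : fglift f (- x : {freeg K / F}) = - fglift f x.
  by rewrite -sub0r fB f0 sub0r.
have fD : {morph (fglift f : {freeg K / F} -> M) : x y / x + y}.
  by move=> x y; rewrite -{1}(opprK y) fB fN opprK.
have fsum (s : seq K) (E : K -> {freeg K / F}) :
    fglift f (\sum_(k <- s) E k) = \sum_(k <- s) fglift f (E k).
  by elim: s => [|k s IHs]; rewrite ?big_nil ?big_cons// fD IHs.
move=> a x y; rewrite fD; congr (_ + _).
rewrite -{2}[x]freeg_sumE {1}/GRing.scale /= /fgscale !fsum scaler_sumr.
by apply: eq_bigr => k _; rewrite !liftU scalerA.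
Qed.

HB.instance Definition _ := GRing.isLinear.Build F {freeg K / F} M *:%R
  (fglift f : {freeg K / F} -> M) fglift_is_linear.

End FreeModule.

Section OrientedChains.
Context (F : fieldType) (X : choiceType).

Definition vertices n := {ffun 'I_n.+1 -> X}.

Local Notation free n := {freeg (vertices n) / F}.

Definition free_generator n (v : vertices n) : free n := [freeg [:: (1, v)]].

(* Relations defining oriented simplices: [v_0, ..., v_n] is zero if it has a
   repeated vertex, and [v_s(0), ..., v_s(n)] = sgn(s) [v_0, ..., v_n]. The
   first family is not a consequence of the second one in characteristic 2. *)
Definition orientation_relations n : set (free n) :=
  [set free_generator v | v in [set v : vertices n | ~ injective v]] `|`
  [set free_generator [ffun i => vs.1 (vs.2 i)] - (-1) ^+ vs.2 *: free_generator vs.1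
     | vs in [set: vertices n * 'S_n.+1]].

(* Oriented n-chains of the full simplex on the vertex set X; the oriented
   chains of a simplicial complex K on X form the subspace chains n K below. *)
Definition oriented_chains n := lquot (lspan (@orientation_relations n)).
HB.instance Definition _ n := GRing.Lmodule.on (oriented_chains n).

Definition oriented_simplex n (v : vertices n) : oriented_chains n :=
  lpi (lspan (@orientation_relations n)) (free_generator v).

Lemma oriented_simplex_eq0 n (v : vertices n) :
  ~ injective v -> oriented_simplex v = 0.
Proof.
move=> vI; apply/eqP; rewrite -(linear0 (lpi _)) lpi_eq subr0.
by apply: mem_lspan; left; exists v.
Qed.

Lemma oriented_simplex_perm n (v : vertices n) (s : 'S_n.+1) :
  oriented_simplex [ffun i => v (s i)] = (-1) ^+ s *: oriented_simplex v.
Proof.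
apply/eqP; rewrite -linearZ lpi_eq.
by apply: mem_lspan; right; exists (v, s).
Qed.

Definition face n (v : vertices n.+1) (i : 'I_n.+2) : vertices n :=
  [ffun j => v (fintype.lift i j)].

Definition free_boundary n : free n.+1 -> oriented_chains n :=
  fglift (fun v => \sum_(i < n.+2) (-1) ^+ i *: oriented_simplex (face v i)).
HB.instance Definition _ n := GRing.Linear.on (@free_boundary n).

Lemma free_boundaryE n (v : vertices n.+1) :
  free_boundary (free_generator v) =
  \sum_(i < n.+2) (-1) ^+ i *: oriented_simplex (face v i).
Proof. by rewrite /free_boundary /free_generator liftU scale1r. Qed.

Lemma perm_lift n (s : 'S_n.+2) (i : 'I_n.+2) :
  exists t : 'S_n.+1, s = lift_perm i (s i) t.
Proof.
have unl j : exists k, s (fintype.lift i j) = fintype.lift (s i) k.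
  have /unlift_some[k kE _] : s i != s (fintype.lift i j).
    by rewrite (inj_eq perm_inj) neq_lift.
  by exists k.
have [f fE] := choice unl.
have f_inj : injective f.
  move=> j k fjk; apply: (@lift_inj _ i); apply: (@perm_inj _ s).
  by rewrite !fE fjk.
exists (perm f_inj); apply/permP => j.
by have [k ->|->] := unliftP i j; rewrite ?lift_perm_lift ?lift_perm_id// permE fE.
Qed.

Lemma face_perm n (v : vertices n.+1) (s : 'S_n.+2) (i : 'I_n.+2) :
  (-1) ^+ i *: oriented_simplex (face [ffun j => v (s j)] i) =
  (-1) ^+ s *: ((-1) ^+ s i *: oriented_simplex (face v (s i))).
Proof.
have [t st] := perm_lift s i; set j := s i in st *.
have -> : face [ffun j => v (s j)] i = [ffun k => face v j (t k)].
  by apply/ffunP => k; rewrite !ffunE st lift_perm_lift.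
rewrite oriented_simplex_perm !scalerA st odd_lift_perm; congr (_ *: _).
move: (odd_perm t) => b; rewrite !signr_addb !signr_odd -!mulrA; congr (_ * _).
by rewrite mulrCA -expr2 sqrr_sign mulr1.
Qed.

Lemma free_boundary_relations n :
  {in lspan (@orientation_relations n.+1), forall u, free_boundary u = 0}.
Proof.
have ker_closed : submod_closed [pred u | @free_boundary n u == 0].
  split=> [|a u w]; rewrite !inE; first by rewrite linear0.
  by move=> /eqP u0 /eqP w0; rewrite linearP /= u0 w0 scaler0 addr0.
move=> u /(@lspan_sub _ _ _ (Subspace ker_closed)) uK.
apply/eqP; apply: uK => {}u [[v vI <-]|[[v s] _ <-]]; rewrite !inE.
  have [a [b [ab vab]]] : exists a b, a != b /\ v a = v b.
    apply: contrapT => nab; apply: vI => a b vab; apply: contrapT => /eqP ab.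
    by apply: nab; exists a, b.
  rewrite free_boundaryE (bigD1 a)//= (bigD1 b) 1?eq_sym//= big1.
    have := face_perm v (tperm a b) a.
    have -> : [ffun j => v (tperm a b j)] = v.
      by apply/ffunP => j; rewrite ffunE; case: tpermP => [->|->|].
    by rewrite tpermL odd_tperm ab scaleN1r => ->; rewrite addr0 addNr.
  move=> i /andP[ia ib]; rewrite oriented_simplex_eq0 ?scaler0// => fI.
  have /unlift_some[a' aE _] := ia; have /unlift_some[b' bE _] := ib.
  have : a' = b' by apply: fI; rewrite !ffunE -aE -bE.
  by move=> ab'; rewrite aE bE ab' eqxx in ab.
rewrite linearB linearZ /= !free_boundaryE subr_eq0 scaler_sumr.
rewrite [eqbRHS](reindex_inj (@perm_inj _ s)) /=.
by apply/eqP/eq_bigr => i _; rewrite face_perm.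
Qed.

(* [v_0, ..., v_(n+1)] |-> \sum_i (-1)^i [v_0, ..., v_(i-1), v_(i+1), ...] *)
Definition boundary n : oriented_chains n.+1 -> oriented_chains n :=
  lquot_lift (@free_boundary_relations n).
HB.instance Definition _ n := GRing.Linear.on (@boundary n).

Lemma boundaryE n (v : vertices n.+1) :
  boundary (oriented_simplex v) =
  \sum_(i < n.+2) (-1) ^+ i *: oriented_simplex (face v i).
Proof. by rewrite /boundary lquot_liftE /= free_boundaryE. Qed.

End OrientedChains.
Arguments free_generator : simpl never.
Arguments oriented_simplex : simpl never.
Arguments free_boundary : simpl never.
Arguments boundary : simpl never.

Record simplicial_complex (X : Type) := SimplicialComplex {
  simplex :> set (set X);
  simplex_finite : forall A, simplex A -> finite_set A;
  simplex_neq0 : forall A, simplex A -> A !=set0;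
  simplex_face : forall A B, simplex A -> B !=set0 -> B `<=` A -> simplex B }.

Section Homology.
Context (F : fieldType) (X : choiceType) (n : nat).

Definition chains m (K : simplicial_complex X) : subspace (oriented_chains F X m) :=
  lspan [set oriented_simplex F v | v in [set v : vertices X m | simplex K (range v)]].

Definition is_cycle m : oriented_chains F X m -> Prop :=
  if m is m'.+1 then fun c => boundary c = 0 else fun=> True.

Lemma is_cycle0 m : @is_cycle m 0.
Proof. by case: m => [//|m]; exact: linear0. Qed.

Lemma is_cycleP m a (u w : oriented_chains F X m) :
  is_cycle u -> is_cycle w -> is_cycle (a *: u + w).
Proof.
case: m u w => [//|m] u w /= u0 w0.
by rewrite linearP /= u0 w0 scaler0 addr0.
Qed.

Lemma cycles_submod_closed (K : simplicial_complex X) :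
  submod_closed [pred c | `[< c \in chains n K /\ is_cycle c >]].
Proof.
split=> [|a u w]; first by apply/asboolP; split; [exact: rpred0|exact: is_cycle0].
move=> /asboolP[uK u0] /asboolP[wK w0]; apply/asboolP; split.
  by rewrite rpredD ?rpredZ.
exact: is_cycleP.
Qed.

Definition cycles (K : simplicial_complex X) := Subspace (cycles_submod_closed K).

Lemma boundaries_submod_closed (K : simplicial_complex X) :
  submod_closed [pred c : oriented_chains F X n |
    `[< exists2 b, b \in chains n.+1 K & c = boundary b >]].
Proof.
split; first by apply/asboolP; exists 0; rewrite ?rpred0 ?linear0.
move=> a u w /asboolP[b bK ->] /asboolP[c cK ->]; apply/asboolP.
by exists (a *: b + c); rewrite ?linearP ?rpredD ?rpredZ.
Qed.

Definition boundaries (K : simplicial_complex X) :=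
  Subspace (boundaries_submod_closed K).

(* Z_n(K) / B_n(K); since boundary \o boundary = 0, boundaries K is contained in
   cycles K, so that the trace is boundaries K itself, as a subspace of cycles K. *)
Definition homology (K : simplicial_complex X) : lmodType F :=
  lquot (lsub_trace (cycles K) (boundaries K)).

Definition homology_class (K : simplicial_complex X) :
    {linear lsub (cycles K) -> homology K} :=
  lpi (lsub_trace (cycles K) (boundaries K)).

Section Inclusion.
Context (K L : simplicial_complex X) (KL : simplex K `<=` simplex L).

Lemma chains_sub m : {subset chains m K <= chains m L}.
Proof.
by apply: lspan_sub => _ [v vK <-]; apply: mem_lspan; exists v => //; exact: KL.
Qed.

Lemma cycles_sub : {subset cycles K <= cycles L}.
Proof. move=> c /asboolP[cK c0]; apply/asboolP.
by split; first exact: chains_sub. Qed.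

Lemma boundaries_sub : {subset boundaries K <= boundaries L}.
Proof.
move=> c /asboolP[b bK ->]; apply/asboolP.
by exists b => //; exact: chains_sub.
Qed.

Lemma homology_class_incl0 :
  {in lsub_trace (cycles K) (boundaries K),
    forall c, (homology_class L \o lsub_incl cycles_sub) c = 0}.
Proof.
move=> c cB; apply/eqP.
rewrite /= -(linear0 (homology_class L)) lpi_eq subr0.
exact: (boundaries_sub (cB : val c \in boundaries K)).
Qed.

(* The map induced in homology by the inclusion of K in L: [c] |-> [c]. *)
Definition homology_incl : {linear homology K -> homology L} :=
  lquot_lift homology_class_incl0.

Lemma homology_inclE c :
  homology_incl (homology_class K c) = homology_class L (lsub_incl cycles_sub c).
Proof. exact: lquot_liftE. Qed.

End Inclusion.

Lemma homology_incl_id (K : simplicial_complex X)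
  (KK : simplex K `<=` simplex K) h : homology_incl KK h = h.
Proof.
have [c ->] := lpi_surj h; rewrite [LHS]homology_inclE.
by congr (lpi _ _); exact: val_inj.
Qed.

Lemma homology_incl_comp (K L M : simplicial_complex X)
    (KL : simplex K `<=` simplex L) (LM : simplex L `<=` simplex M)
    (KM : simplex K `<=` simplex M) h :
  homology_incl KM h = homology_incl LM (homology_incl KL h).
Proof.
have [c ->] := lpi_surj h.
rewrite [LHS]homology_inclE [X in _ = homology_incl LM X]homology_inclE.
by rewrite [RHS]homology_inclE; congr (lpi _ _); exact: val_inj.
Qed.

End Homology.

(* The power set of 'I_k ordered by inclusion, i.e. {subset 'I_k}; that notation
   clashes here with {subset A <= B}. *)
Definition Pk (k : nat) :=
  Order.SetSubsetOrder.type Order.SetSubsetOrder.subset_display 'I_k.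
HB.instance Definition _ k := Order.POrder.on (Pk k).

Section PersistenceModules.
Context (F : fieldType).

(* Functors from the poset category Q to F-vector spaces. *)
Record pmodule d (Q : porderType d) := PModule {
  pm_space :> Q -> lmodType F;
  pm_map : forall x y : Q, (x <= y)%O -> {linear pm_space x -> pm_space y};
  pm_map_id : forall x (xx : (x <= x)%O) v, pm_map xx v = v;
  pm_map_comp : forall x y z (xy : (x <= y)%O) (yz : (y <= z)%O) (xz : (x <= z)%O) v,
    pm_map xz v = pm_map yz (pm_map xy v) }.

Record pmorphism d (Q : porderType d) (V W : pmodule Q) := PMorphism {
  pmor_map :> forall x, {linear V x -> W x};
  pmor_natural : forall x y (xy : (x <= y)%O) v,
    pmor_map y (pm_map V xy v) = pm_map W xy (pmor_map x v) }.

Section Precomposition.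
Context d d' (Q : porderType d) (Q' : porderType d') (f : Q -> Q').
Context (f_homo : {homo f : x y / (x <= y)%O}) (V : pmodule Q').

Definition pm_precomp : pmodule Q := @PModule d Q
  (fun x => V (f x)) (fun x y xy => pm_map V (f_homo xy))
  (fun x xx v => pm_map_id (f_homo xx) v)
  (fun x y z xy yz xz v =>
     pm_map_comp (f_homo xy) (f_homo yz) (f_homo xz) v).

End Precomposition.

Section Interleaving.
Context (R : realType) d (P : porderType d).
Local Notation RP := (R *p P)%type.

Definition shift_index (e : R) (x : RP) : RP := (x.1 + e, x.2).

Lemma shift_index_homo e : {homo shift_index e : x y / (x <= y)%O}.
Proof. by move=> x y; rewrite !leEprod /= lerD2r. Qed.

Definition pm_shift (e : R) (V : pmodule RP) : pmodule RP :=
  pm_precomp (@shift_index_homo e) V.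

Lemma le_shift2 e x : 0 <= e -> (x <= shift_index e (shift_index e x))%O.
Proof. by move=> e0; rewrite leEprod /= lexx andbT -addrA lerDl addr_ge0. Qed.

(* The index r + 2e is realized as (r + e) + e. *)
Definition interleaved (e : R) (e0 : 0 <= e) (V W : pmodule RP) : Prop :=
  exists (phi : pmorphism V (pm_shift e W)) (psi : pmorphism W (pm_shift e V)),
    (forall x v, psi (shift_index e x) (phi x v) = pm_map V (le_shift2 x e0) v) /\
    (forall x w, phi (shift_index e x) (psi x w) = pm_map W (le_shift2 x e0) w).

Definition interleaving_dist (V W : pmodule RP) : \bar R :=
  ereal_inf [set e%:E | e in [set e | exists e0 : 0 <= e, interleaved e0 V W]].

End Interleaving.

Section SymmetricInterleaving.
Context (R : realType) (k : nat).
Local Notation RPk := (R *p Pk k)%type.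

Definition perm_act (s : 'S_k) (x : RPk) : RPk :=
  (x.1, (s @: (x.2 : {set 'I_k}))%SET : Pk k).

Lemma perm_act_homo s : {homo perm_act s : x y / (x <= y)%O}.
Proof.
move=> x y; rewrite !leEprod /= => /andP[-> /=].
by rewrite !leEsubset; exact: imsetS.
Qed.

Definition pm_perm (s : 'S_k) (V : pmodule RPk) : pmodule RPk :=
  pm_precomp (@perm_act_homo s) V.

Definition interleaving_dist_sym (V W : pmodule RPk) : \bar R :=
  \big[mine/+oo%E]_(s : 'S_k) interleaving_dist (pm_perm s V) W.

End SymmetricInterleaving.

End PersistenceModules.

Record labeled_metric_space (R : realType) (k : nat) := LabeledMetricSpace {
  lms_space :> metricType R;
  lms_compact : compact [set: lms_space];
  label : 'I_k -> set lms_space;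
  label_neq0 : forall i, label i !=set0;
  label_cover : \bigcup_i label i = [set: lms_space] }.
Arguments label {R k} X i : rename.
Arguments label_neq0 {R k} X i : rename.
Arguments label_cover {R k} X : rename.
Arguments lms_compact {R k} X : rename.

Section GromovHausdorff.
Context (R : realType).

Definition correspondence (A B : Type) (a : set A) (b : set B) : set (set (A * B)) :=
  [set C | fst @` C = a /\ snd @` C = b].

Definition distortion (X Y : metricType R) (C D : set (X * Y)) : \bar R :=
  ereal_sup [set `|mdist p.1 q.1 - mdist p.2 q.2|%:E | p in C & q in D].

Context (k : nat).

Definition GH (X Y : labeled_metric_space R k) : \bar R :=
  (2^-1%:E * ereal_inf
    [set \big[maxe/-oo]_(i < k) \big[maxe/-oo]_(j < k) distortion (C i) (C j)
       | C in [set C : 'I_k -> set (X * Y) |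
                forall i, correspondence (label X i) (label Y i) (C i)]])%E.

Lemma perm_label_cover (s : 'S_k) (X : labeled_metric_space R k) :
  \bigcup_i label X (s i) = [set: X].
Proof.
rewrite -(label_cover X); apply/seteqP; split=> x [i _ xi].
  by exists (s i).
by exists (s^-1%g i) => //; rewrite permKV.
Qed.

Definition lms_perm (s : 'S_k) (X : labeled_metric_space R k) :=
  LabeledMetricSpace (lms_compact X) (fun i => label_neq0 X (s i))
    (perm_label_cover s X).

Definition GH_sym (X Y : labeled_metric_space R k) : \bar R :=
  \big[mine/+oo%E]_(s : 'S_k) GH (lms_perm s X) Y.

End GromovHausdorff.

Section LabeledPersistentHomology.
Context (F : fieldType) (R : realType).

Definition diameter (X : metricType R) (A : set X) : \bar R :=
  ereal_sup [set (mdist x y)%:E | x in A & y in A].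

Definition rips_simplex (X : metricType R) (r : R) (S : set X) : set (set X) :=
  [set A | [/\ finite_set A, A !=set0, A `<=` S & (diameter A <= r%:E)%E]].

Lemma diameter_sub (X : metricType R) (A B : set X) :
  A `<=` B -> (diameter A <= diameter B)%E.
Proof.
move=> AB; apply: ereal_sup_le => _ [x Ax [y Ay <-]].
by exists x; [exact: AB|exists y => //; exact: AB].
Qed.

Lemma rips_face (X : metricType R) (r : R) (S : set X) (A B : set X) :
  rips_simplex r S A -> B !=set0 -> B `<=` A -> rips_simplex r S B.
Proof.
move=> [fA _ AS dA] B0 BA; split => //.
- exact: sub_finite_set fA.
- exact: subset_trans AS.
- exact: le_trans (diameter_sub BA) dA.
Qed.

Definition vietoris_rips (X : metricType R) (r : R) (S : set X) :
    simplicial_complex X :=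
  @SimplicialComplex X (rips_simplex r S)
    (fun A => fun '(And4 fA _ _ _) => fA) (fun A => fun '(And4 _ A0 _ _) => A0)
    (@rips_face X r S).

Lemma vietoris_rips_sub (X : metricType R) (r s : R) (S T : set X) :
  r <= s -> S `<=` T ->
  simplex (vietoris_rips r S) `<=` simplex (vietoris_rips s T).
Proof.
move=> rs ST A [fA A0 AS dA]; split => //; first exact: subset_trans ST.
by apply: le_trans dA _; rewrite lee_fin.
Qed.

Context (k : nat) (X : labeled_metric_space R k) (n : nat).
Local Notation RPk := (R *p Pk k)%type.

Definition labels_union (p : {set 'I_k}) : set X :=
  \bigcup_(i in [set i | i \in p]) label X i.

Definition LPH_complex (x : RPk) : simplicial_complex X :=
  vietoris_rips x.1 (labels_union x.2).

Lemma LPH_complex_sub (x y : RPk) : (x <= y)%O ->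
  simplex (LPH_complex x) `<=` simplex (LPH_complex y).
Proof.
rewrite leEprod leEsubset => /andP[xy1 /fintype.subsetP xy2].
apply: vietoris_rips_sub => // z [i ix xi]; exists i => //; exact: xy2.
Qed.

Definition LPH : pmodule F RPk := @PModule F _ RPk
  (fun x => homology F n (LPH_complex x))
  (fun x y xy => homology_incl F n (LPH_complex_sub xy))
  (fun x xx v => homology_incl_id (LPH_complex_sub xx) v)
  (fun x y z xy yz xz v => homology_incl_comp (LPH_complex_sub xy)
     (LPH_complex_sub yz) (LPH_complex_sub xz) v).

End LabeledPersistentHomology.

(* Main.v *)
(* Permuting the labels of X permutes the index sets of its labeled persistent
   homology, so it suffices to interleave for one permutation and one tuple of
   correspondences (C_i). For each set p of labels choose maps between the
   unions of the X_i and of the Y_i, i \in p, whose graphs lie in the union of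
   the C_i, i \in p. If all distortions are at most e, these are simplicial from
   scale r to scale r + e. Any two such choices are contiguous, hence agree in
   homology; this gives naturality in p and the interleaving identities, although
   no single map between X and Y need respect all labels at once. *)
From HB Require Import structures.
Require Import Defs.
From mathcomp Require Import all_boot all_order all_fingroup all_algebra.
From mathcomp Require Import all_classical all_reals ereal.
From mathcomp Require Import freeg.

Set Implicit Arguments.
Unset Strict Implicit.
Unset Printing Implicit Defensive.

Import Order.TTheory GRing.Theory Num.Theory.
Import preorder.Order.SetSubsetOrder.Exports Order.SetSubsetOrder.Exports.

Local Open Scope classical_set_scope.
Local Open Scope ring_scope.

(** * Oriented chains *)

Section LinearSpan.
Context (F : fieldType) (V W : lmodType F) (G : set V).

Lemma eq_lspan (f g : {linear V -> W}) :
  (forall v, G v -> f v = g v) -> {in lspan G, f =1 g}.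
Proof.
move=> fg _ /asboolP[s sG ->]; rewrite !linear_sum big_seq [RHS]big_seq.
by apply: eq_bigr => p ps; rewrite !linearZ /= fg//; exact: sG.
Qed.

Lemma lspan_image (f : {linear V -> W}) (S : Defs.subspace W) :
  (forall v, G v -> f v \in S) -> {in lspan G, forall v, f v \in S}.
Proof.
move=> fS _ /asboolP[s sG ->]; rewrite linear_sum big_seq.
by apply: rpred_sum => p ps; rewrite linearZ /= rpredZ// fS//; exact: sG.
Qed.

End LinearSpan.

Section OrientedLift.
Context (F : fieldType) (X : choiceType) (n : nat).

(** Every chain is the class of a finite combination of free generators. Taking a subspace as
    induction predicate provides closure under such combinations. *)
Lemma oriented_chains_ind (S : Defs.subspace (oriented_chains F X n)) :
  (forall v, oriented_simplex F v \in S) -> forall c, c \in S.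
Proof.
move=> vS c; have [u ->] := lpi_surj c.
pose p : {linear {freeg (vertices X n) / F} -> oriented_chains F X n} :=
  lpi (lspan (@orientation_relations F X n)).
rewrite -[X in X \in S]/(p u) -[u]freeg_sumE linear_sum.
apply: rpred_sum => v _.
have -> : << coeff v u *g v >> = coeff v u *: free_generator F v.
  by apply/eqP/freeg_eqP => w; rewrite coeffZ !coeffU mul1r.
by rewrite linearZ rpredZ//; exact: vS.
Qed.

Lemma oriented_chains_span (c : oriented_chains F X n) :
  c \in lspan (range (@oriented_simplex F X n)).
Proof. by apply: oriented_chains_ind => v; apply: mem_lspan; exists v. Qed.

Lemma eq_oriented_chains (M : lmodType F)
    (f g : {linear oriented_chains F X n -> M}) :
  (forall v, f (oriented_simplex F v) = g (oriented_simplex F v)) -> f =1 g.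
Proof.
by move=> fg c; apply: eq_lspan (oriented_chains_span c) => _ [v _ <-].
Qed.

Context (M : lmodType F) (t : vertices X n -> M).
Hypothesis t0 : forall v : vertices X n, ~ injective v -> t v = 0.
Hypothesis tperm : forall (v : vertices X n) (s : 'S_n.+1),
  t [ffun i => v (s i)] = (-1) ^+ s *: t v.

Lemma oriented_lift0 :
  {in lspan (@orientation_relations F X n), forall u,
    (fglift t : {freeg (vertices X n) / F} -> M) u = 0}.
Proof.
move=> u /(@eq_lspan _ _ _ _ (fglift t : {freeg (vertices X n) / F} -> M) \0).
apply=> {}u [[v vI <-]|[[v s] _ <-]] /=; rewrite /free_generator.
  by rewrite liftU scale1r t0.
by rewrite linearB linearZ /= !liftU !scale1r tperm subrr.
Qed.

(** Universal property of oriented chains: a map on vertex tuples extends linearly once it kills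
    tuples with a repeated vertex and is alternating. The first condition is separate because of
    characteristic 2. *)
Definition oriented_lift : oriented_chains F X n -> M :=
  lquot_lift oriented_lift0.
HB.instance Definition _ := GRing.Linear.on oriented_lift.

Lemma oriented_liftE v : oriented_lift (oriented_simplex F v) = t v.
Proof.
by rewrite [LHS]lquot_liftE /= /free_generator liftU scale1r.
Qed.

End OrientedLift.
Arguments oriented_lift : simpl never.

(** * Cones over oriented simplices *)

Section Vertices.
Context (X : choiceType).

Definition vmap (Y : choiceType) (f : X -> Y) n (v : vertices X n) :
  vertices Y n := [ffun i => f (v i)].

Definition vcons (a : X) n (v : vertices X n) : vertices X n.+1 :=
  [ffun i => if unlift ord0 i is Some j then v j else a].

Lemma face_vmap (Y : choiceType) (f : X -> Y) n (v : vertices X n.+1) i :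
  face (vmap f v) i = vmap f (face v i).
Proof. by apply/ffunP => j; rewrite !ffunE. Qed.

Lemma face_vcons0 a n (v : vertices X n) : face (vcons a v) ord0 = v.
Proof. by apply/ffunP => j; rewrite !ffunE liftK. Qed.

Lemma face_vconsS a n (v : vertices X n.+1) (i : 'I_n.+2) :
  face (vcons a v) (fintype.lift ord0 i) = vcons a (face v i).
Proof.
apply/ffunP => j; rewrite !ffunE; case: (unliftP ord0 j) => [k ->|->].
  have -> : fintype.lift (fintype.lift ord0 i) (fintype.lift ord0 k) =
    fintype.lift ord0 (fintype.lift i k) by apply: val_inj; rewrite /= !bumpS.
  by rewrite liftK ffunE.
have -> : fintype.lift (fintype.lift ord0 i) ord0 = ord0 :> 'I_n.+3.
  exact: val_inj.
by rewrite unlift_none.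
Qed.

Lemma face_vcons_point a (v : vertices X 0) :
  face (vcons a v) (fintype.lift ord0 ord0) = [ffun=> a].
Proof.
apply/ffunP => j; rewrite !ffunE.
have -> : fintype.lift (fintype.lift ord0 ord0) j = ord0 :> 'I_2.
  by rewrite [j]ord1; exact: val_inj.
by rewrite unlift_none.
Qed.

Lemma vcons_ninj a n (v : vertices X n) :
  ~ injective v -> ~ injective (vcons a v).
Proof.
move=> nv cv; apply: nv => i j vij; apply: (@lift_inj _ ord0).
by apply: cv; rewrite !ffunE !liftK.
Qed.

Lemma vmap_ninj (Y : choiceType) (f : X -> Y) n (v : vertices X n) :
  ~ injective v -> ~ injective (vmap f v).
Proof.
by move=> nv fv; apply: nv => i j vij; apply: fv; rewrite !ffunE vij.
Qed.

Context (F : fieldType).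

Lemma oriented_simplex_vcons_perm a n (v : vertices X n) (s : 'S_n.+1) :
  oriented_simplex F (vcons a [ffun i => v (s i)]) =
  (-1) ^+ s *: oriented_simplex F (vcons a v).
Proof.
have -> : vcons a [ffun i => v (s i)] =
    [ffun i => vcons a v (lift_perm ord0 ord0 s i)].
  apply/ffunP => i; rewrite !ffunE.
  case: unliftP => [j ->|->]; first by rewrite lift_perm_lift liftK ffunE.
  by rewrite lift_perm_id unlift_none.
by rewrite oriented_simplex_perm odd_lift_perm.
Qed.

(** Moving vertex [i] to the front is a cycle of sign [(-1) ^+ i], realized by
    [lift_perm i ord0 1]. *)
Lemma oriented_simplex_vcons_face n (v : vertices X n.+1) (i : 'I_n.+2) :
  oriented_simplex F v =
  (-1) ^+ i *: oriented_simplex F (vcons (v i) (face v i)).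
Proof.
have {1}-> : v = [ffun j => vcons (v i) (face v i) (lift_perm i ord0 1 j)].
  apply/ffunP => j; rewrite !ffunE.
  case: (unliftP i j) => [k ->|->].
    by rewrite lift_perm_lift liftK perm1 ffunE.
  by rewrite lift_perm_id unlift_none.
by rewrite oriented_simplex_perm odd_lift_perm odd_perm1 addbF addbF signr_odd.
Qed.

(** The face opposite the apex is the base. The other faces are cones over faces of the base with
    index shifted by one, whence the minus sign. *)
Lemma boundary_vcons a n (v : vertices X n.+1) :
  boundary (oriented_simplex F (vcons a v)) = oriented_simplex F v -
  \sum_(i < n.+2) (-1) ^+ i *: oriented_simplex F (vcons a (face v i)).
Proof.
rewrite boundaryE big_ord_recl face_vcons0 expr0 scale1r; congr (_ + _).
rewrite -sumrN; apply: eq_bigr => i _.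
by rewrite face_vconsS lift0 exprS mulN1r scaleNr.
Qed.

(** Dimension 0 stands apart: deleting the base vertex leaves the apex alone, not a cone over a
    face. *)
Lemma boundary_vcons_point a (v : vertices X 0) :
  boundary (oriented_simplex F (vcons a v)) =
  oriented_simplex F v - oriented_simplex F [ffun=> a].
Proof.
rewrite boundaryE big_ord_recl face_vcons0 expr0 scale1r big_ord_recl big_ord0.
by rewrite addr0 face_vcons_point lift0 expr1 scaleN1r.
Qed.

End Vertices.

(** * Chain maps induced by vertex maps *)

Section PushForward.
Context (F : fieldType) (X Y : choiceType) (f : X -> Y) (n : nat).

Lemma vmap_perm (v : vertices X n) (s : 'S_n.+1) :
  vmap f [ffun i => v (s i)] = [ffun i => vmap f v (s i)].
Proof. by apply/ffunP => i; rewrite !ffunE. Qed.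

Let t (v : vertices X n) := oriented_simplex F (vmap f v).

Let t0 (v : vertices X n) : ~ injective v -> t v = 0.
Proof. by move=> nv; rewrite /t oriented_simplex_eq0//; exact: vmap_ninj. Qed.

Let tperm (v : vertices X n) (s : 'S_n.+1) :
  t [ffun i => v (s i)] = (-1) ^+ s *: t v.
Proof. by rewrite /t vmap_perm oriented_simplex_perm. Qed.

Definition push : oriented_chains F X n -> oriented_chains F Y n :=
  oriented_lift t0 tperm.
HB.instance Definition _ := GRing.Linear.on push.

Lemma pushE v : push (oriented_simplex F v) = oriented_simplex F (vmap f v).
Proof. exact: oriented_liftE. Qed.

End PushForward.
Arguments push : simpl never.

Lemma boundary_push (F : fieldType) (X Y : choiceType) (f : X -> Y) n
    (c : oriented_chains F X n.+1) :
  boundary (push f c) = push f (boundary c).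
Proof.
apply: (@eq_oriented_chains F X _ _ (@boundary F Y n \o @push F X Y f n.+1)
  (@push F X Y f n \o @boundary F X n)) => v.
rewrite /= pushE !boundaryE linear_sum; apply: eq_bigr => i _.
by rewrite linearZ /= pushE face_vmap.
Qed.

(** * Chain homotopy between maps that differ at one vertex *)

Section VertexHomotopy.
Context (F : fieldType) (X Y : choiceType) (f g : X -> Y) (x : X).
Hypothesis fg : forall y, y != x -> f y = g y.

Section Homotopy.
Context (n : nat).

(** If [x] is a vertex of [v], the simplex on [f x], [g x] and the common images of the other
    vertices has both images of [v] among its faces. Otherwise the two images coincide and zero
    suffices. *)
Let t (v : vertices X n) :=
  if x \in codom v then oriented_simplex F (vcons (f x) (vmap g v)) else 0.

Let t0 (v : vertices X n) : ~ injective v -> t v = 0.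
Proof.
move=> nv; rewrite /t; case: ifP => // _.
by rewrite oriented_simplex_eq0//; exact/vcons_ninj/vmap_ninj.
Qed.

Let tperm (v : vertices X n) (s : 'S_n.+1) :
  t [ffun i => v (s i)] = (-1) ^+ s *: t v.
Proof.
rewrite /t vmap_perm oriented_simplex_vcons_perm.
have -> : (x \in codom [ffun i => v (s i)]) = (x \in codom v).
  apply/codomP/codomP => -[i ->]; first by exists (s i); rewrite ffunE.
  by exists (s^-1%g i); rewrite ffunE permKV.
by case: ifP => // _; rewrite scaler0.
Qed.

Definition vertex_homotopy :
    oriented_chains F X n -> oriented_chains F Y n.+1 :=
  oriented_lift t0 tperm.
HB.instance Definition _ := GRing.Linear.on vertex_homotopy.

Lemma vertex_homotopyE v : vertex_homotopy (oriented_simplex F v) =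
  if x \in codom v then oriented_simplex F (vcons (f x) (vmap g v)) else 0.
Proof. exact: oriented_liftE. Qed.

Lemma vmap_notin_codom (v : vertices X n) :
  x \notin codom v -> vmap f v = vmap g v.
Proof.
move=> xv; apply/ffunP => i; rewrite !ffunE fg//.
by apply: contraNneq xv => <-; exact: codom_f.
Qed.

End Homotopy.
Arguments vertex_homotopy : simpl never.

Lemma boundary_vertex_homotopy0 (c : oriented_chains F X 0) :
  boundary (vertex_homotopy c) = push g c - push f c.
Proof.
apply: (@eq_oriented_chains F X _ _ (@boundary F Y 0 \o @vertex_homotopy 0)
  (@push F X Y g 0 \- @push F X Y f 0)) => v.
rewrite /= vertex_homotopyE !pushE.
case: ifPn => [/codomP[i xE]|/vmap_notin_codom->].
  rewrite boundary_vcons_point; congr (_ - oriented_simplex F _).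
  by apply/ffunP => j; rewrite !ffunE xE [i]ord1 [j]ord1.
by rewrite linear0 subrr.
Qed.

(** The base of the cone is the image under [g]. The cones over faces of the base cancel against the
    homotopy of the boundary, except at the face that misses [x], where the image under [f]
    remains. *)
Lemma boundary_vertex_homotopy n (c : oriented_chains F X n.+1) :
  boundary (vertex_homotopy c) =
  push g c - push f c - vertex_homotopy (boundary c).
Proof.
apply: (@eq_oriented_chains F X _ _
  (@boundary F Y n.+1 \o @vertex_homotopy n.+1)
  (@push F X Y g n.+1 \- @push F X Y f n.+1 \-
    (@vertex_homotopy n \o @boundary F X n))) => v.
(* On degenerate [v] all terms vanish. For injective [v], [x] occurs at most at one index [i], so
   face [i] misses it. *)
have [vI|nv] := pselect (injective v); last first.
  by rewrite oriented_simplex_eq0// !linear0.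
rewrite /= vertex_homotopyE !pushE boundaryE linear_sum /=.
case: ifPn => [/codomP[i xE]|xv]; last first.
  rewrite linear0 (vmap_notin_codom xv) subrr sub0r big1 ?oppr0// => j _.
  rewrite linearZ /= vertex_homotopyE ifN ?scaler0//.
  apply: contra xv => /codomP[k ->]; rewrite ffunE; exact: codom_f.
rewrite boundary_vcons -addrA; congr (_ + _); rewrite -opprD; congr (- _).
have xface : x \notin codom (face v i).
  apply/negP => /codomP[k]; rewrite ffunE xE => /vI/eqP.
  by rewrite (negbTE (neq_lift _ _)).
rewrite (bigD1 i)//= [in RHS](bigD1 i)//= linearZ /= vertex_homotopyE ifN//.
(* The face opposite x has no homotopy term; there the cone from f x is f v. *)
rewrite scaler0 add0r; congr (_ + _).
  rewrite (oriented_simplex_vcons_face F (vmap f v) i) ffunE -xE !face_vmap.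
  by rewrite (vmap_notin_codom xface).
apply: eq_bigr => j ji; rewrite linearZ /= vertex_homotopyE face_vmap ifT//.
have /unlift_some[k iE _] := ji.
by apply/codomP; exists k; rewrite ffunE -iE.
Qed.

End VertexHomotopy.

Lemma push_comp (F : fieldType) (X Y Z : choiceType) (f : X -> Y) (g : Y -> Z) n
    (c : oriented_chains F X n) :
  push g (push f c) = push (g \o f) c.
Proof.
apply: (@eq_oriented_chains F X _ _ (@push F Y Z g n \o @push F X Y f n)
  (@push F X Z (g \o f) n)) => v.
by rewrite /= !pushE; congr oriented_simplex; apply/ffunP => i; rewrite !ffunE.
Qed.

Lemma push_id (F : fieldType) (X : choiceType) n (c : oriented_chains F X n) :
  push id c = c.
Proof.
apply: (@eq_oriented_chains F X _ _ (@push F X X id n) idfun) => v.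
by rewrite /= pushE; congr oriented_simplex; apply/ffunP => i; rewrite ffunE.
Qed.

(** The list [s] collects the vertices of the finitely many simplices in [c]; it permits an
    induction over vertices even if [X] is infinite. *)
Lemma push_finite_support (F : fieldType) (X Y : choiceType) n
    (c : oriented_chains F X n) :
  exists s : seq X, forall f g : X -> Y, {in s, f =1 g} -> push f c = push g c.
Proof.
have /asboolP[l lG ->] := oriented_chains_span c.
elim: l lG => [|[a u] l IHl] lG.
  by exists [::] => f g _; rewrite big_nil !linear0.
have [v _ /= uE] := lG (a, u) (mem_head _ _).
have [|s sE] := IHl; first by move=> p pl; apply: lG; rewrite inE pl orbT.
exists (codom v ++ s) => f g fg; rewrite !big_cons !linearD !linearZ /=.
rewrite (sE f g) => [|y ys]; last by rewrite fg// mem_cat ys orbT.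
congr (_ *: _ + _); rewrite -uE !pushE; congr oriented_simplex.
by apply/ffunP => i; rewrite !ffunE fg// mem_cat codom_f.
Qed.

(** * Contiguous maps *)

Definition simplicial (X Y : Type) (K : simplicial_complex X)
    (L : simplicial_complex Y) (f : X -> Y) :=
  forall A, simplex K A -> simplex L (f @` A).

Definition contiguous (X Y : Type) (K : simplicial_complex X)
    (L : simplicial_complex Y) (f g : X -> Y) :=
  forall A, simplex K A -> simplex L (f @` A `|` g @` A).

Section Contiguity.
Context (F : fieldType) (X Y : choiceType).
Context (K : simplicial_complex X) (L : simplicial_complex Y).

Lemma range_vmap (f : X -> Y) n (v : vertices X n) :
  range (vmap f v) = f @` range v.
Proof.
apply/seteqP; split=> [_ [i _ <-]|_ [_ [i _ <-] <-]].
  by exists (v i); [exists i|rewrite ffunE].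
by exists i => //; rewrite ffunE.
Qed.

Lemma chains_push (f : X -> Y) n : simplicial K L f ->
  {in chains F n K, forall c, push f c \in chains F n L}.
Proof.
move=> fKL; apply: (@lspan_image _ _ _ _ (@push F X Y f n)) => _ [v vK <-] /=.
rewrite pushE mem_lspan//; exists (vmap f v) => //=.
by rewrite range_vmap; exact: fKL.
Qed.

Lemma is_cycle_push (f : X -> Y) n (c : oriented_chains F X n) :
  is_cycle c -> is_cycle (push f c).
Proof. by case: n c => // n c /= c0; rewrite boundary_push c0 linear0. Qed.

Lemma cycles_push (f : X -> Y) n : simplicial K L f ->
  {in cycles F n K, forall c, push f c \in cycles F n L}.
Proof.
move=> fKL c /asboolP[cK c0]; apply/asboolP.
by split; [exact: chains_push|exact: is_cycle_push].
Qed.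

Lemma boundaries_push (f : X -> Y) n : simplicial K L f ->
  {in boundaries F n K, forall c, push f c \in boundaries F n L}.
Proof.
move=> fKL c /asboolP[b bK ->]; apply/asboolP; exists (push f b).
  exact: chains_push.
by rewrite boundary_push.
Qed.

(** The vertex homotopy of [c] bounds the difference: the correction term vanishes on a cycle and is
    absent in degree 0. *)
Lemma push_vertex_contiguous (f g : X -> Y) x n : contiguous K L f g ->
  (forall y, y != x -> f y = g y) ->
  {in cycles F n K, forall c, push g c - push f c \in boundaries F n L}.
Proof.
move=> fgKL fg c /asboolP[cK c0]; apply/asboolP.
exists (vertex_homotopy f g x c); last first.
  case: n c c0 {cK} => [c _|n c /= c0].
    by rewrite boundary_vertex_homotopy0.
  by rewrite boundary_vertex_homotopy// c0 linear0 subr0.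
apply: (@lspan_image _ _ _ _ (@vertex_homotopy F X Y f g x n)) cK.
move=> _ [v vK <-] /=.
rewrite vertex_homotopyE; case: ifPn => [/codomP[i xE]|_]; last first.
  exact: (rpred0 (chains F n.+1 L)).
apply: mem_lspan; exists (vcons (f x) (vmap g v)) => //=.
(* The cone is spanned by points of the two images of [range v], which together form a simplex of
   [L] by contiguity. *)
apply: (simplex_face (fgKL _ vK)).
  by exists (f x); exists ord0; rewrite // ffunE unlift_none.
move=> _ [j _ <-]; rewrite ffunE; case: unliftP => [k _|_].
  by right; rewrite ffunE; exists (v k) => //; exists k.
by left; exists x => //; exists i.
Qed.

(* The maps are changed into one another at one vertex of c at a time; this
   avoids ordering the vertices, which the prism operator would require. *)
Lemma push_contiguous (f g : X -> Y) n : contiguous K L f g ->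
  {in cycles F n K, forall c, push g c - push f c \in boundaries F n L}.
Proof.
move=> fgKL c cK.
(* These maps interpolate from [f], at the empty list, to [g], once [s] contains all vertices of
   [c]. *)
pose h (s : seq X) y := if y \in s then g y else f y.
have hL A s t : simplex K A -> simplex L (h s @` A `|` h t @` A).
  move=> KA; apply: (simplex_face (fgKL _ KA)).
    by have [a Aa] := simplex_neq0 KA; exists (h s a); left; exists a.
  move=> _ [] [a Aa <-]; rewrite /h; case: ifP => _;
    by [right; exists a|left; exists a].
have [s sE] := push_finite_support Y c.
have <- : push (h s) c = push g c by apply: sE => y ys; rewrite /h ys.
elim: s {sE} => [|x s IHs]; first by rewrite subrr rpred0.
(* Telescoping through [h s]: it differs from [h (x :: s)] at most at [x]. *)
rewrite -(subrKA (push (h s) c)) rpredD//.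
apply: (@push_vertex_contiguous _ _ x) => // [A KA|y yx]; first exact: hL.
by rewrite /h inE (negbTE yx).
Qed.

End Contiguity.

(** * Induced maps in homology *)

Section HomologyMap.
Context (F : fieldType) (X Y : choiceType) (n : nat).
Context (K : simplicial_complex X) (L : simplicial_complex Y).
Context (f : X -> Y) (fKL : simplicial K L f).

Definition cycle_map (c : lsub (cycles F n K)) : lsub (cycles F n L) :=
  exist _ (push f (val c)) (cycles_push fKL (valP c)).

Lemma cycle_map_is_linear : linear cycle_map.
Proof.
move=> a u v; apply: val_inj.
rewrite [RHS](linearP (val : lsub (cycles F n L) -> _)).
by rewrite /= -(linearP (@push F X Y f n)).
Qed.

HB.instance Definition _ := GRing.isLinear.Build F (lsub (cycles F n K))
  (lsub (cycles F n L)) *:%R cycle_map cycle_map_is_linear.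

Lemma homology_class_map0 :
  {in lsub_trace (cycles F n K) (boundaries F n K),
    forall c, (homology_class F n L \o cycle_map) c = 0}.
Proof.
move=> c cB; apply/eqP.
rewrite /= -(linear0 (homology_class F n L)) lpi_eq subr0.
exact: (boundaries_push fKL (cB : val c \in boundaries F n K)).
Qed.

Definition homology_map : {linear homology F n K -> homology F n L} :=
  lquot_lift homology_class_map0.

Lemma homology_mapE c :
  homology_map (homology_class F n K c) = homology_class F n L (cycle_map c).
Proof. exact: lquot_liftE. Qed.

End HomologyMap.
Arguments homology_map F {X Y} n {K L f} fKL.

Section HomologyMapTheory.
Context (F : fieldType) (n : nat).

Lemma homology_map_comp (X Y Z : choiceType) (K : simplicial_complex X)
    (L : simplicial_complex Y) (M : simplicial_complex Z) (f : X -> Y)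
    (g : Y -> Z) (fKL : simplicial K L f) (gLM : simplicial L M g)
    (gfKM : simplicial K M (g \o f)) h :
  homology_map F n gLM (homology_map F n fKL h) = homology_map F n gfKM h.
Proof.
have [c ->] := lpi_surj h.
rewrite [X in homology_map F n gLM X = _]homology_mapE.
rewrite [LHS]homology_mapE [RHS]homology_mapE; congr (lpi _ _); apply: val_inj.
exact: push_comp.
Qed.

(** Treating inclusions as maps induced by [id] lets composites with them be computed on
    vertices. *)
Lemma homology_inclE_map (X : choiceType) (K L : simplicial_complex X)
    (KL : simplex K `<=` simplex L) (idKL : simplicial K L id) h :
  homology_incl F n KL h = homology_map F n idKL h.
Proof.
have [c ->] := lpi_surj h.
rewrite [LHS]homology_inclE [RHS]homology_mapE; congr (lpi _ _).
by apply: val_inj; rewrite /= push_id.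
Qed.

Lemma homology_map_contiguous (X Y : choiceType) (K : simplicial_complex X)
    (L : simplicial_complex Y) (f g : X -> Y) (fKL : simplicial K L f)
    (gKL : simplicial K L g) h :
  contiguous K L g f -> homology_map F n fKL h = homology_map F n gKL h.
Proof.
move=> fgKL; have [c ->] := lpi_surj h.
rewrite [LHS]homology_mapE [RHS]homology_mapE; apply/eqP; rewrite lpi_eq.
exact: (push_contiguous fgKL (valP c)).
Qed.

End HomologyMapTheory.

Section HomologyMapContiguity.
Context (X Y : choiceType).
Context (K : simplicial_complex X) (L : simplicial_complex Y).

Lemma contiguous_simplicial (f : X -> Y) :
  contiguous K L f f -> simplicial K L f.
Proof. by move=> fKL A /fKL; rewrite setUid. Qed.

(** Both composites come from vertex maps [K] to [L'], namely [f'] and [f]. This yields the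
    naturality squares of the interleaving morphisms. *)
Lemma homology_map_incl_contiguous (F : fieldType) n (K' : simplicial_complex X)
    (L' : simplicial_complex Y) (f f' : X -> Y)
    (fKL : simplicial K L f) (fKL' : simplicial K' L' f')
    (KK' : simplex K `<=` simplex K') (LL' : simplex L `<=` simplex L') h :
  contiguous K L' f f' ->
  homology_map F n fKL' (homology_incl F n KK' h) =
  homology_incl F n LL' (homology_map F n fKL h).
Proof.
move=> ff'.
have idK : simplicial K K' id by move=> A /KK'; rewrite image_id.
have idL : simplicial L L' id by move=> A /LL'; rewrite image_id.
have fKL1 : simplicial K L' (f' \o id) by move=> A /KK'/fKL'.
have fKL2 : simplicial K L' (id \o f) by move=> A /fKL/LL'.
rewrite (homology_inclE_map KK' idK) (homology_inclE_map LL' idL).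
rewrite (homology_map_comp _ _ fKL1) (homology_map_comp _ _ fKL2).
exact: homology_map_contiguous.
Qed.

(** The composite is induced by [g \o f] and the inclusion by [id]. This yields the interleaving
    identities. *)
Lemma homology_map_comp_incl (F : fieldType) n (M : simplicial_complex X)
    (f : X -> Y) (g : Y -> X) (fKL : simplicial K L f) (gLM : simplicial L M g)
    (KM : simplex K `<=` simplex M) h :
  contiguous K M id (g \o f) ->
  homology_map F n gLM (homology_map F n fKL h) = homology_incl F n KM h.
Proof.
move=> gf.
have idK : simplicial K M id by move=> A /KM; rewrite image_id.
have gfKM : simplicial K M (g \o f).
  by move=> A /fKL/gLM; rewrite image_comp.
rewrite (homology_inclE_map KM idK) (homology_map_comp _ _ gfKM).
exact: homology_map_contiguous.
Qed.

End HomologyMapContiguity.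

(** * Vietoris-Rips complexes and interleavings *)

Lemma diameter_leP (R : realType) (X : metricType R) (A : set X)
    (r : R) :
  (diameter A <= r%:E)%E <-> {in A &, forall x y, mdist x y <= r}.
Proof.
split=> [Ar x y /set_mem Ax /set_mem Ay|Ar].
  rewrite -lee_fin; apply: le_trans Ar; apply: ereal_sup_ubound.
  by exists x => //; exists y.
apply: ge_ereal_sup => _ [x Ax [y Ay <-]].
by rewrite lee_fin Ar// inE.
Qed.

Section RipsMaps.
Context (R : realType) (X Y : metricType R).

(** The map is total on [X] but constrained only on [S]; its values elsewhere are arbitrary. *)
Definition selection (U : X -> Y -> Prop) (S : set X) (T : set Y)
    (f : X -> Y) :=
  forall x, S x -> U x (f x) /\ T (f x).

(** Each point of either image of a simplex [A] is related by [U] to a point of [A], so the bound on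
    [U] controls all distances, including those between a value of [f] and a value of [g]. *)
Lemma rips_contiguous (U : X -> Y -> Prop)
    (S : set X) (T : set Y) (r e t : R) (f g : X -> Y) :
  (forall x y x' y', U x y -> U x' y' -> mdist y y' <= mdist x x' + e) ->
  r + e <= t -> selection U S T f -> selection U S T g ->
  contiguous (vietoris_rips r S) (vietoris_rips t T) f g.
Proof.
move=> Ue ret fU gU A [finA [a Aa] AS /diameter_leP Ar]; split.
- by rewrite finite_setU; split; exact: finite_image.
- by exists (f a); left; exists a.
- by move=> _ [] [x /AS Sx <-]; [have [] := fU x Sx|have [] := gU x Sx].
have fgA y : (f @` A `|` g @` A) y -> exists2 x, A x & U x y.
  by move=> [] [x Ax <-]; exists x => //; have Sx := AS x Ax;
    [have [] := fU x Sx|have [] := gU x Sx].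
apply/diameter_leP => y y' /set_mem/fgA[x Ax Uxy] /set_mem/fgA[x' Ax' Uxy'].
apply: le_trans (Ue _ _ _ _ Uxy Uxy') _; apply: le_trans ret.
by rewrite lerD2r Ar// inE.
Qed.

End RipsMaps.

(** * The interleaving built from a tuple of correspondences *)

Section CorrespondenceInterleaving.
Context (R : realType) (k : nat) (X Y : labeled_metric_space R k) (s : 'S_k).
Context (C : 'I_k -> set (X * Y)) (e : R).
Hypothesis hk : (0 < k)%N.
Hypothesis C_corr : forall i, correspondence (label X (s i)) (label Y i) (C i).
Hypothesis C_dist : forall i j p q, C i p -> C j q ->
  `|mdist p.1 q.1 - mdist p.2 q.2| <= e.
Hypothesis e0 : 0 <= e.

(** The image under [s] appears because [pm_perm s] evaluates the module of [X] at the permuted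
    label set. *)
Local Notation SX p := (@labels_union R k X (s @: (p : {set 'I_k}))%SET).
Local Notation SY p := (@labels_union R k Y p).

(** A correspondence between [SX p] and [SY p], of distortion at most [e] because [C_dist] also
    compares pairs from different labels. *)
Let U (p : Pk k) x y := exists2 i, i \in (p : {set 'I_k}) & C i (x, y).

Let U_le (p q : Pk k) x y : (p <= q)%O -> U p x y -> U q x y.
Proof.
by rewrite leEsubset => /fintype.subsetP pq [i /pq iq Ci]; exists i.
Qed.

Let SX_le (p q : Pk k) : (p <= q)%O -> SX p `<=` SX q.
Proof.
rewrite leEsubset => pq x [i ip xi]; exists i => //.
by move: i ip {xi}; exact/fintype.subsetP/imsetS.
Qed.

Let SY_le (p q : Pk k) : (p <= q)%O -> SY p `<=` SY q.
Proof.
rewrite leEsubset => /fintype.subsetP pq y [i ip yi].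
by exists i => //; exact: pq.
Qed.

Let U_SX p x y : U p x y -> SX p x.
Proof.
move=> [i ip Cxy]; exists (s i); first by rewrite /= imset_f.
by have [<- _] := C_corr i; exists (x, y).
Qed.

Let U_SY p x y : U p x y -> SY p y.
Proof.
by move=> [i ip Cxy]; exists i => //; have [_ <-] := C_corr i; exists (x, y).
Qed.

Let U_total p x : SX p x -> exists y, U p x y.
Proof.
move=> [_ /imsetP[i ip ->]]; have [<- _] := C_corr i => -[[x' y] Cxy /= <-].
by exists y, i.
Qed.

Let U_onto p y : SY p y -> exists x, U p x y.
Proof.
move=> [i ip]; have [_ <-] := C_corr i => -[[x y'] Cxy /= <-].
by exists x, i.
Qed.

Let U_distY p x y x' y' : U p x y -> U p x' y' ->
  mdist y y' <= mdist x x' + e.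
Proof.
move=> [i _ Ci] [j _ Cj]; have := C_dist Ci Cj.
by rewrite ler_distlC /= => /andP[_]; rewrite addrC.
Qed.

Let U_distX p x y x' y' : U p x y -> U p x' y' ->
  mdist x x' <= mdist y y' + e.
Proof.
move=> [i _ Ci] [j _ Cj]; have := C_dist Ci Cj.
by rewrite ler_distl /= => /andP[_].
Qed.

Let Uop p y x := U p x y.

(* One selection per subset of labels: a single map X -> Y cannot in general
   respect all the labels, as a point may have several of them. *)
Let selections : exists2 f : Pk k -> X -> Y,
  (forall p, selection (U p) (SX p) (SY p) (f p)) &
  exists g : Pk k -> Y -> X, forall p, selection (Uop p) (SY p) (SX p) (g p).
Proof.
(* [x0] and [y0] are default values outside the unions; they exist because there is at least one
   label and labels are nonempty. *)
have [x0 _] := label_neq0 X (Ordinal hk).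
have [y0 _] := label_neq0 Y (Ordinal hk).
have fex p : exists f, selection (U p) (SX p) (SY p) f.
  have /choice[f fP] : forall x, exists y, SX p x -> U p x y.
    move=> x; have [/U_total[y xy]|nx] := pselect (SX p x); first by exists y.
    by exists y0.
  by exists f => x /fP xy; split=> //; exact: U_SY xy.
have gex p : exists g, selection (Uop p) (SY p) (SX p) g.
  have /choice[g gP] : forall y, exists x, SY p y -> U p x y.
    move=> y; have [/U_onto[x xy]|ny] := pselect (SY p y); first by exists x.
    by exists x0.
  by exists g => y /gP xy; split=> //; exact: U_SX xy.
have [f fP] := choice fex; have [g gP] := choice gex.
by exists f => //; exists g.
Qed.

Lemma correspondence_interleaved (F : fieldType) n :
  interleaved e0 (pm_perm s (LPH F X n)) (LPH F Y n).
Proof.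
have [f fP [g gP]] := selections.
(* On [SX p], both [f p] and [f q] select from [U q]. The case [p = q] makes [f p] simplicial; the
   general case gives naturality. *)
have f_cont (p q : Pk k) r t : (p <= q)%O -> r + e <= t ->
    contiguous (vietoris_rips r (SX p)) (vietoris_rips t (SY q)) (f p) (f q).
  move=> pq ret; apply: (rips_contiguous (@U_distY q) ret) => x px.
    by have [/(U_le pq) ? /(SY_le pq)] := fP p x px.
  exact/fP/(SX_le pq).
have g_cont (p q : Pk k) r t : (p <= q)%O -> r + e <= t ->
    contiguous (vietoris_rips r (SY p)) (vietoris_rips t (SX q)) (g p) (g q).
  move=> pq ret; apply: (@rips_contiguous _ _ _ (Uop q) _ _ _ e).
  - by move=> y x y' x'; exact: U_distX.
  - exact: ret.
  - by move=> y py; have [/(U_le pq) ? /(SX_le pq)] := gP p y py.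
  - by move=> y py; exact/gP/(SY_le pq).
have f_simp (x : R *p Pk k) : simplicial (LPH_complex X (perm_act s x))
    (LPH_complex Y (shift_index e x)) (f x.2).
  exact/contiguous_simplicial/f_cont.
have g_simp (x : R *p Pk k) : simplicial (LPH_complex Y x)
    (LPH_complex X (perm_act s (shift_index e x))) (g x.2).
  exact/contiguous_simplicial/g_cont.
pose V := pm_perm s (LPH F X n); pose W := LPH F Y n.
have f_nat (x y : R *p Pk k) (xy : (x <= y)%O) v :
    homology_map F n (f_simp y) (pm_map V xy v) =
    pm_map (pm_shift e W) xy (homology_map F n (f_simp x) v).
  apply: homology_map_incl_contiguous.
  move: (xy); rewrite leEprod => /andP[xy1 xy2].
  by apply: f_cont => //; rewrite lerD2r.
have g_nat (x y : R *p Pk k) (xy : (x <= y)%O) w :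
    homology_map F n (g_simp y) (pm_map W xy w) =
    pm_map (pm_shift e V) xy (homology_map F n (g_simp x) w).
  apply: homology_map_incl_contiguous.
  move: (xy); rewrite leEprod => /andP[xy1 xy2].
  by apply: g_cont => //; rewrite lerD2r.
exists (@PMorphism F _ _ V (pm_shift e W)
  (fun x => homology_map F n (f_simp x)) f_nat).
exists (@PMorphism F _ _ W (pm_shift e V)
  (fun x => homology_map F n (g_simp x)) g_nat).
split=> x v; apply: homology_map_comp_incl.
  (* Points sharing a partner in [Y]: passing to the partners and back costs [e] twice. Both [id]
     and the round trip select from [U2], the latter with partner [f x.2 a]. *)
  pose U2 (x1 x2 : X) := exists2 y, U x.2 x1 y & U x.2 x2 y.
  apply: (@rips_contiguous _ _ _ U2 _ _ _ (e + e)).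
  - move=> x1 z1 x2 z2 [y1 xy1 zy1] [y2 xy2 zy2].
    apply: le_trans (U_distX zy1 zy2) _.
    by rewrite addrA lerD2r; exact: U_distY xy1 xy2.
  - by rewrite /= addrA.
  - by move=> a Sa; split=> //; have [y ay] := U_total Sa; exists y.
  - move=> a Sa; have [afa fa] := fP x.2 a Sa; have [gfa ga] := gP x.2 _ fa.
    by split=> //; exists (f x.2 a).
pose U2 (y1 y2 : Y) := exists2 z, U x.2 z y1 & U x.2 z y2.
apply: (@rips_contiguous _ _ _ U2 _ _ _ (e + e)).
- move=> y1 z1 y2 z2 [x1 xy1 xz1] [x2 xy2 xz2].
  apply: le_trans (U_distY xz1 xz2) _.
  by rewrite addrA lerD2r; exact: U_distX xy1 xy2.
- by rewrite /= addrA.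
- by move=> b Sb; split=> //; have [z zb] := U_onto Sb; exists z.
- move=> b Sb; have [bgb gb] := gP x.2 b Sb; have [fgb fb] := fP x.2 _ gb.
  by split=> //; exists (g x.2 b).
Qed.

End CorrespondenceInterleaving.

(** * Passage to the infimum and to the minimum over permutations *)

Local Open Scope ereal_scope.

(** The factor 2 cancels the one half in [GH], leaving an infimum over tuples of correspondences;
    each finite maximal distortion is itself an interleaving parameter. *)
Lemma interleaving_dist_le_GH (R : realType) (F : fieldType) (k : nat)
    (hk : (0 < k)%N) (X Y : labeled_metric_space R k) (s : 'S_k) (n : nat) :
  interleaving_dist (pm_perm s (LPH F X n)) (LPH F Y n) <=
  2%:E * GH (lms_perm s X) Y.
Proof.
rewrite /GH muleA -EFinM divff ?pnatr_eq0// mul1e.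
apply: le_ereal_inf_tmp => _ [C C_corr <-].
set m := \big[_/_]_(_ < k) _.
have dis_le i j : distortion (C i) (C j) <= m.
  apply: le_trans (le_bigmax _ _ i); exact: (le_bigmax _ _ j).
have C_dist i j p q : C i p -> C j q ->
    `|mdist p.1 q.1 - mdist p.2 q.2|%:E <= m.
  move=> Cp Cq; apply: le_trans (dis_le i j); apply: ereal_sup_ubound.
  by exists p => //; exists q.
(* The maximum starts from [-oo], so an actual pair in some [C i] is exhibited, using a nonempty
   label. *)
have m0 : 0 <= m.
  pose i := Ordinal hk; have [x lx] := label_neq0 X (s i).
  have [Cx _] := C_corr i; move: lx; rewrite -[label _ _]Cx => -[p Cp _].
  by apply: le_trans (C_dist _ _ _ _ Cp Cp); rewrite lee_fin.
case: m m0 {dis_le} C_dist => [e| |]// e0 C_dist; last by rewrite leey.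
rewrite lee_fin in e0.
apply: ereal_inf_lbound; exists e => //=; exists e0.
apply: (@correspondence_interleaved _ _ X Y s C e hk C_corr) => i j p q Cp Cq.
by rewrite -lee_fin; exact: C_dist Cp Cq.
Qed.

Local Close Scope ereal_scope.

Theorem corollary3p3p3 (R : realType) (F : fieldType) (k : nat) (hk : (0 < k)%N)
    (X Y : labeled_metric_space R k) (j : nat) :
  (interleaving_dist_sym (LPH F X j) (LPH F Y j) <= 2%:E * GH_sym X Y)%E.
Proof.
(* Induction on the minimum on the right: the bound holds for its initial value [+oo], passes to a
   minimum of two values, and for each [s] the left minimum is at most its own term at [s]. *)
rewrite /GH_sym; elim/big_ind: _ => [|a b aP bP|s _].
- by rewrite gt0_muley ?leey// lte_fin.
- by rewrite /mine; case: ifP.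
apply: le_trans (interleaving_dist_le_GH F hk X Y s j).
exact: bigmin_le.
Qed.
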